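(* In the trusted-correlation model, let the verifier accept ''benign'' iff the sample conditional variance $$\hat N=\frac1{N_{\mathrm{PE}}}\sum_{i=1}^{N_{\mathrm{PE}}}\Big(y_i-\frac{c}{V_A}x_{A,i}\Big)^2$$ satisfies $\hat N\le N_0$, where $c=\sqrt{\eta T_0}\,V_A$ is known. Consider an attack with true conditional variance $N^\star$, put $r^\star=N^\star/N_0>1$, so that $N_{\mathrm{PE}}\hat N/N^\star\sim\chi^2_{N_{\mathrm{PE}}}$. Then for every $N_{\mathrm{PE}}\ge1$ the missed-detection probability $\varepsilon_{\mathrm{PE}}=\Pr[\hat N\le N_0]$ under the attack obeys $$\varepsilon_{\mathrm{PE}}\le\exp\big(-N_{\mathrm{PE}}\,\psi(r^\star)\big),\qquad \psi(r)=\tfrac12\Big(\tfrac1r-1+\ln r\Big).$$ Moreover, as $r^\star\to1$, $\psi(r^\star)=\tfrac14(r^\star-1)^2+O((r^\star-1)^3)$.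
   Context: Constants $V_A>0$, $\eta\in(0,1]$, $v_{\mathrm{el}}\ge0$, benign parameters $T_0\in(0,1]$, $\xi_0\ge0$, and $N_0=1+v_{\mathrm{el}}+\eta T_0\xi_0$. In the trusted-correlation model $V_A$ and the correlation $c=\sqrt{\eta T_0}V_A$ are monitored and an attack changes only the excess noise $\xi$, so the data $(x_{A,i},y_i)$, $i=1,\dots,N_{\mathrm{PE}}$, are i.i.d. centered bivariate Gaussian with $\operatorname{Var}(x_A)=V_A$, $\operatorname{Cov}(x_A,y)=c$ and conditional variance $\operatorname{Var}(y\mid x_A)=N^\star=1+v_{\mathrm{el}}+\eta T_0\xi^\star$. $\chi^2_n$ denotes the chi-squared distribution with $n$ degrees of freedom. *)

(* Defs.v *)
From HB Require Import structures.
From mathcomp Require Import all_boot all_order all_algebra.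
From mathcomp Require Import all_classical all_reals all_analysis.
Export numFieldNormedType.Exports.

Set Implicit Arguments.
Unset Strict Implicit.
Unset Printing Implicit Defensive.

Import Order.TTheory GRing.Theory Num.Theory.

Local Open Scope classical_set_scope.
Local Open Scope ring_scope.

Definition mutually_independent d d' (T : measurableType d)
    (T' : measurableType d') (R : realType) (P : probability T R)
    (I : finType) (Z : I -> T -> T') : Prop :=
  forall (J : {set I}) (A : I -> set T'), (forall i, measurable (A i)) ->
    P [set w | forall i, i \in J -> A i (Z i w)] =
    (\prod_(i in J) P (Z i @^-1` A i))%E.

Definition identically_distributed d d' (T : measurableType d)
    (T' : measurableType d') (R : realType) (P : probability T R)
    (I : Type) (Z : I -> T -> T') : Prop :=
  forall i j (A : set T'), measurable A -> P (Z i @^-1` A) = P (Z j @^-1` A).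

(* Density of N(0, S) with S = [[sx, sxy], [sxy, sy]], det S > 0; the
   quadratic form is (u, v) S^-1 (u, v)^T. *)
Definition gauss2_pdf (R : realType) (sx sxy sy : R) (z : R * R) : R :=
  let D := sx * sy - sxy ^+ 2 in
  (2 * pi * Num.sqrt D)^-1 *
  expR (- (sy * z.1 ^+ 2 - 2 * sxy * z.1 * z.2 + sx * z.2 ^+ 2) / (2 * D)).

(* Non-degenerate case only. A Gaussian pair (X, Y) with Var X > 0 and
   Var(Y | X) > 0 is never degenerate. *)
Definition centered_bivariate_gaussian d (T : measurableType d)
    (R : realType) (P : probability T R) (X Y : T -> R) : Prop :=
  exists sx sxy sy : R, [/\ 0 < sx, 0 < sx * sy - sxy ^+ 2 &
    forall A : set (R * R), measurable A ->
      P [set w | A (X w, Y w)] =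
      (\int[lebesgue_measure \x lebesgue_measure]_(z in A)
         (gauss2_pdf sx sxy sy z)%:E)%E].

(* m is a version of the regression function u |-> E[Y | X = u]. *)
Definition is_condexp d (T : measurableType d) (R : realType)
    (P : probability T R) (X Y : T -> R) (m : R -> R) : Prop :=
  [/\ P.-integrable setT (EFin \o Y),
      measurable_fun setT m,
      P.-integrable setT (EFin \o (m \o X)) &
      forall B : set R, measurable B ->
        (\int[P]_(w in X @^-1` B) (m (X w))%:E =
         \int[P]_(w in X @^-1` B) (Y w)%:E)%E].

(* v is a version of u |-> Var(Y | X = u) = E[(Y - E[Y | X])^2 | X = u]. *)
Definition is_condvar d (T : measurableType d) (R : realType)
    (P : probability T R) (X Y : T -> R) (v : R -> R) : Prop :=
  exists2 m : R -> R, is_condexp P X Y m &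
    is_condexp P X (fun w => (Y w - m (X w)) ^+ 2) v.

(* mu is the law of Z_0^2 + ... + Z_{n-1}^2 for i.i.d. standard normal Z_i. *)
Definition is_chi2_law (R : realType) (n : nat) (mu : set R -> \bar R) : Prop :=
  exists (d : measure_display) (T : measurableType d) (P : probability T R)
    (Z : 'I_n -> {RV P >-> R}),
    [/\ mutually_independent P (fun i => Z i : T -> R),
        forall i (A : set R), measurable A ->
          P (Z i @^-1` A) = normal_prob 0 1 A &
        forall A : set R, measurable A ->
          mu A = P [set w | A (\sum_(i < n) Z i w ^+ 2)]].

Definition noise (R : realType) (v_el eta T0 xi : R) : R :=
  1 + v_el + eta * T0 * xi.

Definition trusted_corr (R : realType) (eta T0 V_A : R) : R :=
  Num.sqrt (eta * T0) * V_A.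

Definition trusted_correlation_data d (T : measurableType d) (R : realType)
    (P : probability T R) (n : nat) (V_A c N : R)
    (x y : 'I_n -> {RV P >-> R}) : Prop :=
  [/\ mutually_independent P (fun i w => (x i w, y i w)),
      identically_distributed P (fun i w => (x i w, y i w)) &
      forall i, [/\ centered_bivariate_gaussian P (x i) (y i),
                    'V_P[x i] = V_A%:E,
                    covariance P (x i) (y i) = c%:E &
                    is_condvar P (x i) (y i) (fun=> N)]].

Definition sample_condvar (R : realType) (T : Type) (n : nat) (V_A c : R)
    (x y : 'I_n -> T -> R) (w : T) : R :=
  n%:R^-1 * \sum_(i < n) (y i w - c / V_A * x i w) ^+ 2.

Definition psi (R : realType) (r : R) : R := 2^-1 * (r^-1 - 1 + ln r).

(* Main.v *)
(* The residual Y - (c / V_A) X of a regression of jointly Gaussian variables,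
   divided by its standard deviation, is a standard normal variable Z, and
   (X, Z) has the same law as (X, - Z). This symmetry kills all cross moments
   of X and Z, so that the given covariance and conditional variance identify
   the regression coefficient c / V_A and the residual variance N. The sample
   conditional variance is thus a rescaled chi-squared variable, and its lower
   tail is bounded by the Chernoff method with
   E[exp (- t Z^2)] = (1 + 2 t)^(-1/2) at t = (r - 1) / 2. *)
Require Import Defs.
From HB Require Import structures.
From mathcomp Require Import all_boot all_order all_algebra.
From mathcomp Require Import all_classical all_reals all_analysis.
From mathcomp Require Import measurable_realfun ring lra.
Set Implicit Arguments.
Unset Strict Implicit.
Unset Printing Implicit Defensive.
Import Order.TTheory GRing.Theory Num.Theory.
Local Open Scope classical_set_scope.
Local Open Scope ring_scope.

(** * Integrals determined by indicator functions *)

Section integral_ext.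
Local Open Scope ereal_scope.
Import HBNNSimple.

Lemma integral_mkcond_indic d (T : measurableType d) (R : realType)
    (mu : {measure set T -> \bar R}) (D : set T) (f : T -> \bar R) :
  \int[mu]_(x in D) f x = \int[mu]_x (f x * (\1_D x)%:E).
Proof. by rewrite integral_mkcond epatch_indic. Qed.

Lemma integral_indic_preimage d d' (T : measurableType d)
    (S : measurableType d') (R : realType) (mu : {measure set T -> \bar R})
    (Z : T -> S) (A : set S) :
  measurable_fun [set: T] Z -> measurable A ->
  \int[mu]_x (\1_A (Z x))%:E = mu (Z @^-1` A).
Proof.
move=> mZ mA.
rewrite (integral_indic mu measurableT (A := Z @^-1` A)) ?setIT //.
by rewrite -[X in measurable X]setTI; exact: mZ.
Qed.

(** A simple function is a finite combination of indicators of its level sets, so integrals weighted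
    by [g] reduce to indicators of [Z]. *)
Let ge0_integralM_nnsfun d d' (T : measurableType d) (S : measurableType d')
    (R : realType) (mu : {measure set T -> \bar R}) (Z : T -> S)
    (g : T -> \bar R) (h : {nnsfun S >-> R}) :
  measurable_fun setT Z -> measurable_fun [set: T] g -> (forall x, 0 <= g x) ->
  \int[mu]_x (g x * (h (Z x))%:E) =
  \sum_(k \in range h)
    (k%:E * \int[mu]_x (g x * (\1_(h @^-1` [set k]) (Z x))%:E)).
Proof.
move=> mZ mg g0.
have mgk k : measurable_fun [set: T]
    (fun x => g x * (\1_(h @^-1` [set k]) (Z x))%:E).
  apply: emeasurable_funM => //; apply/measurable_EFinP.
  by apply: measurableT_comp => //; exact: measurable_indic.
have gk0 k x : 0 <= g x * (\1_(h @^-1` [set k]) (Z x))%:E.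
  by rewrite mule_ge0 // lee_fin.
transitivity (\int[mu]_x (\sum_(k \in range h)
    (k%:E * (g x * (\1_(h @^-1` [set k]) (Z x))%:E)))).
  apply: eq_integral => x _; rewrite fimfunE -fsumEFin //.
  rewrite ge0_mule_fsumr.
    by apply: eq_fsbigr => k _; rewrite EFinM muleCA.
  by move=> k; rewrite EFinM nnfun_muleindic_ge0.
have kgk0 k x : 0 <= k%:E * (g x * (\1_(h @^-1` [set k]) (Z x))%:E).
  by rewrite muleCA mule_ge0 // nnfun_muleindic_ge0.
rewrite ge0_integral_fsum //; last first.
  by move=> k; exact: emeasurable_funM.
apply: eq_fsbigr => k /[!inE] -[y _ <-].
by rewrite ge0_integralZl // lee_fin.
Qed.

(** Agreement on indicators passes to simple functions by linearity and to [f] by monotone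
    convergence. The weights [g1] and [g2] let one statement serve for changes of variables, for
    replacing a law by its density, and for independence. *)
Lemma ge0_integral_ext d1 d2 d' (T1 : measurableType d1)
    (T2 : measurableType d2) (S : measurableType d') (R : realType)
    (m1 : {measure set T1 -> \bar R}) (m2 : {measure set T2 -> \bar R})
    (Z1 : T1 -> S) (Z2 : T2 -> S) (g1 : T1 -> \bar R) (g2 : T2 -> \bar R) :
  measurable_fun [set: T1] Z1 -> measurable_fun [set: T2] Z2 ->
  measurable_fun [set: T1] g1 -> measurable_fun [set: T2] g2 ->
  (forall x, 0 <= g1 x) -> (forall x, 0 <= g2 x) ->
  (forall A, measurable A -> \int[m1]_x (g1 x * (\1_A (Z1 x))%:E) =
                             \int[m2]_x (g2 x * (\1_A (Z2 x))%:E)) ->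
  forall f : S -> \bar R, measurable_fun [set: S] f -> (forall y, 0 <= f y) ->
  \int[m1]_x (g1 x * f (Z1 x)) = \int[m2]_x (g2 x * f (Z2 x)).
Proof.
move=> mZ1 mZ2 mg1 mg2 g10 g20 H f mf f0.
pose h := nnsfun_approx measurableT mf.
have lim d (T : measurableType d) (mu : {measure set T -> \bar R}) Z g :
    measurable_fun [set: T] Z -> measurable_fun [set: T] g ->
    (forall x, 0 <= g x) ->
    \int[mu]_x (g x * f (Z x)) =
    limn (fun n => \int[mu]_x (g x * (h n (Z x))%:E)).
  move=> mZ mg g0; rewrite -monotone_convergence //.
  - apply: eq_integral => x _; apply/esym/cvg_lim => //.
    have hf n : (h n (Z x))%:E <= f (Z x).
      by rewrite nnsfun_approxE; exact: le_approx.
    have hcvg : (EFin \o h^~ (Z x)) n @[n --> \oo] --> f (Z x).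
      exact: cvg_nnsfun_approx.
    (* The zero cases are split off because [g x] or [f (Z x)] may be infinite, and the product is
       not continuous at 0 times infinity. There the sequence of products is constantly 0. *)
    have [fZ0|fZ0] := eqVneq (f (Z x)) 0.
      rewrite fZ0 mule0; apply: cvg_near_cst; apply: nearW => n.
      by have := hf n; rewrite fZ0 lee_fin => hn0; rewrite (_ : h n _ = 0%R)
        ?mule0 //; apply/eqP; rewrite eq_le hn0 fun_ge0.
    have [gx0|gx0] := eqVneq (g x) 0.
      rewrite gx0 mul0e; apply: cvg_near_cst; apply: nearW => n.
      by rewrite mul0e.
    apply: cvgeM => //; last exact: cvg_cst.
    by rewrite mule_defE (negbTE gx0) (negbTE fZ0).
  - move=> n; apply: emeasurable_funM => //; apply/measurable_EFinP.
    exact: measurableT_comp.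
  - by move=> n x _; rewrite mule_ge0 // lee_fin.
  - move=> x _ m n mn; apply: lee_wpmul2l => //.
    by rewrite lee_fin; exact/lefP/nd_nnsfun_approx.
rewrite !lim //; congr (limn _); apply/funext => n.
rewrite !ge0_integralM_nnsfun //; apply: eq_fsbigr => k _.
by rewrite H //; exact: measurable_sfunP.
Qed.

End integral_ext.

(** * The standard normal distribution *)

(** By uniqueness of Lebesgue measure, it is enough that the rescaled pushforward gives half-open
    intervals their length. *)
Lemma lebesgue_measure_affine_preimage (R : realType) (a s : R) (A : set R) :
  0 < s -> measurable A ->
  (lebesgue_measure A =
   s^-1%:E * lebesgue_measure ((fun y : R => (y - a) / s)%R @^-1` A))%E.
Proof.
move=> s0 mA.
have mphi : measurable_fun [set: measurableTypeR R]
    ((fun y => (y - a) / s) : measurableTypeR R -> measurableTypeR R).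
  by apply: measurable_funM => //; exact: measurable_funB.
have si0 : 0 <= s^-1 by rewrite invr_ge0 ltW.
pose phi : {mfun measurableTypeR R >-> measurableTypeR R} :=
  HB.pack (fun y : measurableTypeR R => (y - a) / s)
    (isMeasurableFun.Build _ _ _ _ _ mphi).
apply: (@lebesgue_measure_unique R
  (mscale (NngNum si0) (pushforward lebesgue_measure phi))) => //.
move=> _ [[u v]] _ <-.
rewrite -[RHS]/(s^-1%:E * lebesgue_measure
  ((fun y : R => (y - a) / s)%R @^-1` `]u, v]%classic))%E.
have -> : (fun y : R => (y - a) / s) @^-1` `]u, v] =
    `](u * s + a), (v * s + a)]%classic.
  apply/seteqP; split => y; rewrite /= !in_itv /= ltr_pdivlMr // ler_pdivrMr //;
    by rewrite ltrBrDr lerBlDr.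
rewrite !lebesgue_measure_itv /= !lte_fin ltrD2r ltr_pM2r //.
case: ifPn => // _; last by rewrite mule0.
by rewrite -!EFinD -EFinM; congr EFin; field; rewrite gt_eqF.
Qed.

Section lebesgue_change_of_variables.
Local Open Scope ereal_scope.
Context (R : realType).
Implicit Types (f h : R -> \bar R) (a s : R).
Local Notation mu := (@lebesgue_measure R).

Let measurable_affine a s :
  measurable_fun [set: R] (fun y : R => (y - a) / s)%R.
Proof. by apply: measurable_funM => //; exact: measurable_funB. Qed.

Lemma ge0_integral_affine f a s : (0 < s)%R ->
  measurable_fun [set: R] f -> (forall x, 0 <= f x) ->
  \int[mu]_y (s^-1%:E * f ((y - a) / s)%R) = \int[mu]_x f x.
Proof.
move=> s0 mf f0; under [RHS]eq_integral do rewrite -[f _]mul1e.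
refine (ge0_integral_ext (m1 := mu) (m2 := mu)
  (Z1 := fun y : R => ((y - a) / s)%R) (Z2 := fun y : R => y)
  (g1 := cst s^-1%:E) (g2 := cst 1) _ _ _ _ _ _ _ mf f0) => //=.
- exact: measurable_affine.
- by move=> _; rewrite lee_fin invr_ge0 ltW.
move=> A mA; rewrite ge0_integralZl //=; last 2 first.
- apply/measurable_EFinP; apply: measurableT_comp (measurable_affine a s).
  exact: measurable_indic.
- by rewrite lee_fin invr_ge0 ltW.
under [RHS]eq_integral do rewrite mul1e.
rewrite (integral_indic_preimage mu (measurable_affine a s) mA).
rewrite (integral_indic_preimage mu (@measurable_id _ R setT) mA).
by rewrite -lebesgue_measure_affine_preimage.
Qed.

Lemma ge0_integral_lebesgueN f :
  measurable_fun [set: R] f -> (forall x, 0 <= f x) ->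
  \int[mu]_y f (- y)%R = \int[mu]_x f x.
Proof.
move=> mf f0; under [RHS]eq_integral do rewrite -[f _]mul1e.
under [LHS]eq_integral do rewrite -[f _]mul1e.
have mN : measurable_fun [set: R] (fun y : R => - y)%R.
  exact: oppr_measurable.
refine (ge0_integral_ext (m1 := mu) (m2 := mu)
  (Z1 := fun y : R => (- y)%R) (Z2 := fun y : R => y)
  (g1 := cst 1) (g2 := cst 1) _ _ _ _ _ _ _ mf f0) => //=.
move=> A mA; under eq_integral do rewrite mul1e.
under [RHS]eq_integral do rewrite mul1e.
rewrite (integral_indic_preimage mu mN mA).
rewrite (integral_indic_preimage mu (@measurable_id _ R setT) mA).
exact: lebesgue_measureN.
Qed.

Lemma normal_pdf_standardize a s y : (0 < s)%R ->
  normal_pdf a s y = (s^-1 * normal_pdf 0 1 ((y - a) / s))%R.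
Proof.
move=> s0; rewrite !normal_pdfE ?gt_eqF //= mulrA; congr (_ * _)%R.
  rewrite /normal_peak expr1n mul1r -mulrnAr sqrtrM ?sqr_ge0 //.
  by rewrite sqrtr_sqr gtr0_norm // invfM.
by rewrite /normal_fun; congr expR; field; rewrite gt_eqF.
Qed.

Lemma normal_pdfN y : normal_pdf 0 1 (- y) = normal_pdf 0 1 y :> R.
Proof.
by rewrite !normal_pdfE ?oner_eq0 // /normal_fun !subr0 sqrrN.
Qed.

Lemma ge0_integral_normal_affine h a s : (0 < s)%R ->
  measurable_fun [set: R] h -> (forall x, 0 <= h x) ->
  \int[mu]_y ((normal_pdf a s y)%:E * h ((y - a) / s)%R) =
  \int[mu]_x ((normal_pdf 0 1 x)%:E * h x).
Proof.
move=> s0 mh h0; rewrite -[RHS](@ge0_integral_affine _ a s) //.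
- by apply: eq_integral => y _; rewrite normal_pdf_standardize // EFinM muleA.
- apply: emeasurable_funM => //; apply/measurable_EFinP.
  exact: measurable_normal_pdf.
- by move=> x; rewrite mule_ge0 // lee_fin normal_pdf_ge0.
Qed.

Lemma ge0_integral_normalN h :
  measurable_fun [set: R] h -> (forall x, 0 <= h x) ->
  \int[mu]_x ((normal_pdf 0 1 x)%:E * h (- x)%R) =
  \int[mu]_x ((normal_pdf 0 1 x)%:E * h x).
Proof.
move=> mh h0.
rewrite -[RHS](ge0_integral_lebesgueN
  (f := fun x => (normal_pdf 0 1 x)%:E * h x)).
- by apply: eq_integral => y _; rewrite normal_pdfN.
- apply: emeasurable_funM => //; apply/measurable_EFinP.
  exact: measurable_normal_pdf.
- by move=> x; rewrite mule_ge0 // lee_fin normal_pdf_ge0.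
Qed.

(** The integrand is [s^-1] times the normal density with standard deviation [s^-1], whose total
    mass is 1. *)
Lemma integral_normal_expR s : (0 < s)%R ->
  \int[mu]_x ((normal_pdf 0 1 x)%:E * (expR ((1 - s ^+ 2) / 2 * x ^+ 2))%:E) =
  s^-1%:E.
Proof.
move=> s0; have si0 : (0 < s^-1)%R by rewrite invr_gt0.
rewrite -[RHS]mule1 -(@integral_normal_pdf R 0 s^-1).
rewrite -ge0_integralZl //; first last.
- by rewrite lee_fin ltW.
- by move=> x _; rewrite lee_fin normal_pdf_ge0.
- by apply/measurable_EFinP; exact: measurable_normal_pdf.
apply: eq_integral => x _; rewrite -!EFinM; congr EFin.
rewrite (normal_pdf_standardize 0 x si0) invrK mulKf ?gt_eqF //.
rewrite !normal_pdfE ?oner_eq0 //= -[LHS]mulrA; congr (_ * _)%R.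
by rewrite /normal_fun -expRD; congr expR; field.
Qed.

(* Both bounds come from [1 + t <= expR t] with [t = (1 - s ^+ 2) / 2 * x ^+ 2]
   in [integral_normal_expR], for [s] close to [1]: from below for [1 < s] and
   from above for [s < 1]. *)
Lemma integral_normal_sqr :
  \int[mu]_x ((normal_pdf 0 1 x)%:E * (x ^+ 2)%:E) = 1 :> \bar R.
Proof.
set m := LHS.
have m0 : 0 <= m.
  apply: integral_ge0 => x _.
  by rewrite mule_ge0 // lee_fin ?normal_pdf_ge0 // sqr_ge0.
have mpdf : measurable_fun [set: R] (fun x => (normal_pdf 0 1 x)%:E : \bar R).
  by apply/measurable_EFinP; exact: measurable_normal_pdf.
have msqr : measurable_fun [set: R] (fun x : R => (x ^+ 2)%:E : \bar R).
  by apply/measurable_EFinP; exact: measurable_funX.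
have mexp s : measurable_fun [set: R]
    (fun x : R => (expR ((1 - s ^+ 2) / 2 * x ^+ 2))%:E : \bar R).
  apply/measurable_EFinP; apply: measurableT_comp => //.
  by apply: measurable_funM => //; exact: measurable_funX.
have pdf0 (x : R) : 0 <= (normal_pdf 0 1 x)%:E.
  by rewrite lee_fin normal_pdf_ge0.
have mpM := emeasurable_funM mpdf msqr.
have mpE s := emeasurable_funM mpdf (mexp s).
have ub s : (0 < s)%R -> (s < 1)%R -> 1 + ((1 - s ^+ 2) / 2)%:E * m <= s^-1%:E.
  move=> s0 s1; have k0 : (0 <= (1 - s ^+ 2) / 2)%R by nra.
  rewrite -(integral_normal_expR s0) -(@integral_normal_pdf R 0 1) /m.
  rewrite -ge0_integralZl //; last first.
    by move=> x _; rewrite mule_ge0 // lee_fin sqr_ge0.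
  rewrite -ge0_integralD //; last 2 first.
  - by move=> x _; rewrite !mule_ge0 // lee_fin // sqr_ge0.
  - by apply: emeasurable_funM => //; exact: mpM.
  apply: ge0_le_integral => //=.
  - by move=> x _; rewrite adde_ge0 // !mule_ge0 // lee_fin // sqr_ge0.
  - by apply: emeasurable_funD => //; exact: emeasurable_funM.
  - exact: mpE.
  move=> x _; rewrite -!EFinM -EFinD lee_fin.
  rewrite mulrCA -[X in (X + _ <= _)%R]mulr1 -mulrDr.
  by rewrite ler_wpM2l ?normal_pdf_ge0 // expR_ge1Dx.
have lb s : (1 < s)%R -> 1 <= s^-1%:E + ((s ^+ 2 - 1) / 2)%:E * m.
  move=> s1; have s0 : (0 < s)%R by lra.
  have k0 : (0 <= (s ^+ 2 - 1) / 2)%R by nra.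
  rewrite -(integral_normal_expR s0) -[leLHS](@integral_normal_pdf R 0 1) /m.
  rewrite -ge0_integralZl //; last first.
    by move=> x _; rewrite mule_ge0 // lee_fin sqr_ge0.
  rewrite -ge0_integralD //; last 4 first.
  - by move=> x _; rewrite mule_ge0 // lee_fin expR_ge0.
  - exact: mpE.
  - by move=> x _; rewrite !mule_ge0 // lee_fin // sqr_ge0.
  - by apply: emeasurable_funM => //; exact: mpM.
  apply: ge0_le_integral => //=.
    apply: emeasurable_funD; first exact: mpE.
    by apply: emeasurable_funM => //; exact: mpM.
  move=> x _; rewrite -!EFinM -EFinD lee_fin.
  rewrite [X in (_ + X)%R]mulrCA -mulrDr -[leLHS]mulr1.
  rewrite ler_wpM2l ?normal_pdf_ge0 // -lerBlDr.
  by apply: le_trans (expR_ge1Dx _); rewrite -mulNr; lra.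
have mfin : m \is a fin_num.
  rewrite ge0_fin_numE // ltey; apply/eqP => moo.
  (* The upper bound at [s = 2^-1] already excludes an infinite second moment. *)
  have h0 : (0 < 2^-1 :> R)%R by lra.
  have h1 : (2^-1 < 1 :> R)%R by lra.
  have := ub _ h0 h1; rewrite moo gt0_muley ?lte_fin; last by nra.
  by rewrite addey.
move: mfin m0 ub lb => /fineK <-; set r := fine m.
rewrite lee_fin => r0 ub lb; congr EFin.
(* Multiplying by [s] and cancelling [1 - s] (below, [s - 1]) leaves polynomial bounds in which [s]
   close to 1 forces [r = 1]. *)
have {}ub s : (0 < s)%R -> (s < 1)%R -> (s * (1 + s) * r <= 2)%R.
  move=> s0 s1; have := ub _ s0 s1; rewrite -EFinM -EFinD lee_fin.
  rewrite -[(s^-1)%R]mul1r ler_pdivlMr // => H.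
  rewrite -(ler_pM2l (_ : 0 < 1 - s)%R) ?subr_gt0 //; nra.
have {}lb s : (1 < s)%R -> (2 <= s * (1 + s) * r)%R.
  move=> s1; have s0 : (0 < s)%R by lra.
  have := lb _ s1; rewrite -EFinM -EFinD lee_fin.
  rewrite -(ler_pM2l s0) mulrDr mulfV ?gt_eqF // => H.
  rewrite -(ler_pM2l (_ : 0 < s - 1)%R) ?subr_gt0 //; nra.
apply/eqP; rewrite eq_le; apply/andP; split; rewrite leNgt; apply/negP => r1.
- have rp : (0 < r)%R by lra.
  (* The midpoint of [r^-1] and 1. The bound then reads [(3 * r - 1) * (r - 1) <= 0], which is false
     for [1 < r]. *)
  have := ub ((r + 1) / (2 * r))%R.
  rewrite divr_gt0 ?ltr_pdivrMr; [|lra..].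
  rewrite (_ : (_ / _ * _ * r = (r + 1) * (3 * r + 1) / (4 * r))%R); last first.
    by field; rewrite gt_eqF.
  rewrite ler_pdivrMr; last by lra.
  move=> H; have : (2 * (4 * r) < (r + 1) * (3 * r + 1))%R by nra.
  by rewrite ltNge H //; lra.
(* With [e = 1 - r > 0], the quantity bounded below by 2 equals
   [2 - e - 8 / 9 * e ^+ 2 - e ^+ 3 / 9]. *)
- have := lb (1 + (1 - r) / 3)%R; rewrite ltrDl => H.
  have {}H : (2 <= (1 + (1 - r) / 3) * (1 + (1 + (1 - r) / 3)) * r)%R.
    by apply: H; lra.
  nra.
Qed.

End lebesgue_change_of_variables.

(** * Residual of a bivariate Gaussian pair *)

Section gaussian_pair.
Context (R : realType) (sx sxy sy : R).
Hypotheses (sx0 : 0 < sx) (D0 : 0 < sx * sy - sxy ^+ 2).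
Local Notation mu := (@lebesgue_measure R).
Let b := sxy / sx.
Let tau := Num.sqrt ((sx * sy - sxy ^+ 2) / sx).

(** Completing the square in [y] splits the joint density into the marginal density of X and the
    conditional density of Y given [X = x], with mean [b * x] and standard deviation [tau]. *)
Lemma gauss2_pdf_factor x y :
  gauss2_pdf sx sxy sy (x, y) =
  normal_pdf 0 (Num.sqrt sx) x * normal_pdf (b * x) tau y.
Proof.
have sxn0 : sx != 0 by rewrite gt_eqF.
have Dn0 : sx * sy - sxy ^+ 2 != 0 by rewrite gt_eqF.
have v0 : 0 < (sx * sy - sxy ^+ 2) / sx by rewrite divr_gt0.
rewrite !normal_pdfE ?gt_eqF ?sqrtr_gt0 //= mulrACA; congr (_ * _).
  rewrite /normal_peak !sqr_sqrtr ?(ltW v0) ?(ltW sx0) // -invfM; congr _^-1.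
  rewrite -sqrtrM; last by rewrite mulrn_wge0 // mulr_ge0 ?pi_ge0 // ltW.
  rewrite [X in _ = Num.sqrt X](_ : _ =
    (2 * pi) ^+ 2 * (sx * sy - sxy ^+ 2)); last by field.
  by rewrite sqrtrM ?sqr_ge0 // sqrtr_sqr gtr0_norm // mulr_gt0 // pi_gt0.
rewrite /normal_fun !sqr_sqrtr ?(ltW v0) ?(ltW sx0) // -expRD; congr expR.
by rewrite /b /=; field; rewrite sxn0.
Qed.

Context d (T : measurableType d) (P : probability T R) (X Y : {RV P >-> R}).
Hypothesis XY : forall A : set (R * R), measurable A ->
  P [set w | A (X w, Y w)] =
  (\int[mu \x mu]_(z in A) (gauss2_pdf sx sxy sy z)%:E)%E.

Let tau0 : 0 < tau. Proof. by rewrite sqrtr_gt0 divr_gt0. Qed.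

Let mgauss2 : measurable_fun [set: R * R] (gauss2_pdf sx sxy sy).
Proof.
rewrite (_ : gauss2_pdf _ _ _ = fun z =>
  normal_pdf 0 (Num.sqrt sx) z.1 *
  (tau^-1 * normal_pdf 0 1 ((z.2 - b * z.1) / tau))).
  apply: measurable_funM.
    by apply: measurableT_comp => //; exact: measurable_normal_pdf.
  apply: measurable_funM => //; apply: measurableT_comp.
    exact: measurable_normal_pdf.
  by apply: measurable_funM => //; apply: measurable_funB => //;
    exact: measurable_funM.
by apply/funext => -[x y]; rewrite gauss2_pdf_factor -normal_pdf_standardize.
Qed.

(** X and the standardized residual have a product law: Tonelli isolates the integral in [y], where
    the substitution [z = (y - b * x) / tau] removes the dependence of the conditional density on
    [x]. *)
Lemma ge0_integral_gauss2 (h : R * R -> \bar R) :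
  measurable_fun [set: R * R] h -> (forall z, (0 <= h z)%E) ->
  (\int[P]_w h (X w, ((Y w - b * X w) / tau)%R) =
   \int[mu]_x ((normal_pdf 0 (Num.sqrt sx) x)%:E *
     \int[mu]_z ((normal_pdf 0 1 z)%:E * h (x, z))))%E.
Proof.
move=> mh h0.
pose f (p : R * R) := h (p.1, (p.2 - b * p.1) / tau).
have mf : measurable_fun [set: R * R] f.
  apply: measurableT_comp => //=; apply: measurable_fun_pair => //=.
  by apply: measurable_funM => //; apply: measurable_funB => //;
    exact: measurable_funM.
have f0 z : (0 <= f z)%E by exact: h0.
have g0 z : 0 <= gauss2_pdf sx sxy sy z.
  by case: z => x y; rewrite gauss2_pdf_factor mulr_ge0 ?normal_pdf_ge0.
have mXY : measurable_fun [set: T] (fun w => (X w, Y w)).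
  exact: measurable_fun_pair.
transitivity (\int[P]_w (1 * f (X w, Y w)))%E.
  by apply: eq_integral => w _; rewrite mul1e.
(* Here [P] with weight 1 is compared with the plane Lebesgue measure weighted by the Gaussian
   density; on indicators this is [XY]. *)
have -> : (\int[P]_w (1 * f (X w, Y w)) =
    \int[mu \x mu]_z ((gauss2_pdf sx sxy sy z)%:E * f z))%E.
  refine (ge0_integral_ext (m1 := P) (m2 := (mu \x mu)%E)
    (Z1 := fun w => (X w, Y w)) (Z2 := fun z : R * R => z)
    (g1 := cst 1%E) (g2 := EFin \o gauss2_pdf sx sxy sy)
    _ _ _ _ _ _ _ mf f0) => //=.
    exact/measurable_EFinP.
  move=> A mA; rewrite -[RHS]integral_mkcond_indic -[RHS]XY //.
  under eq_integral do rewrite mul1e.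
  exact: integral_indic_preimage.
rewrite fubini_tonelli1 //=; first last.
- by move=> z; rewrite mule_ge0 // lee_fin.
- by apply: emeasurable_funM => //; exact/measurable_EFinP.
apply: eq_integral => x _; rewrite /fubini_F /=.
have mhx : measurable_fun [set: R] (fun z : R => h (x, z)).
  apply: measurableT_comp => //.
rewrite -(@ge0_integral_normal_affine _ _ (b * x) tau) //.
rewrite -ge0_integralZl //; first last.
- by rewrite lee_fin normal_pdf_ge0.
- by move=> y _; rewrite mule_ge0 // lee_fin normal_pdf_ge0.
- apply: emeasurable_funM.
    by apply/measurable_EFinP; exact: measurable_normal_pdf.
  apply: (measurableT_comp mhx).
  by apply: measurable_funM => //; exact: measurable_funB.
by apply: eq_integral => y _; rewrite gauss2_pdf_factor /= EFinM muleA.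
Qed.

Let Z w := (Y w - b * X w) / tau.

Let mZ : measurable_fun [set: T] Z.
Proof.
by apply: measurable_funM => //; apply: measurable_funB => //;
    exact: measurable_funM.
Qed.

Lemma ge0_integral_gauss2_residual (f : R -> \bar R) :
  measurable_fun [set: R] f -> (forall z, (0 <= f z)%E) ->
  (\int[P]_w f (Z w) = \int[mu]_z ((normal_pdf 0 1 z)%:E * f z))%E.
Proof.
move=> mf f0; rewrite (ge0_integral_gauss2 (h := f \o snd)) //=; last first.
  exact: measurableT_comp.
rewrite ge0_integralZr //=.
- by rewrite integral_normal_pdf mul1e.
- by apply/measurable_EFinP; exact: measurable_normal_pdf.
- by move=> x _; rewrite lee_fin normal_pdf_ge0.
- by apply: integral_ge0 => x _; rewrite mule_ge0 // lee_fin normal_pdf_ge0.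
Qed.

(** The standard normal density in the inner integral is even. *)
Lemma ge0_integral_gauss2_residualN (h : R * R -> \bar R) :
  measurable_fun [set: R * R] h -> (forall z, (0 <= h z)%E) ->
  (\int[P]_w h (X w, (- Z w)%R) = \int[P]_w h (X w, Z w))%E.
Proof.
move=> mh h0; rewrite [RHS]ge0_integral_gauss2 //.
have mN : measurable_fun [set: R * R] (fun z : R * R => (z.1, - z.2)).
  by apply: measurable_fun_pair => //=; exact: measurableT_comp.
have /= -> := ge0_integral_gauss2 (measurableT_comp mh mN) (fun z => h0 _).
apply: eq_integral => x _; congr (_ * _)%E.
rewrite (ge0_integral_normalN (h := fun z => h (x, z))) //.
exact: measurableT_comp.
Qed.

Lemma integral_gauss2_residual_sqr : (\int[P]_w (Z w ^+ 2)%:E = 1)%E.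
Proof.
rewrite (ge0_integral_gauss2_residual (f := fun z => (z ^+ 2)%:E)).
- exact: integral_normal_sqr.
- by apply/measurable_EFinP; exact: measurable_funX.
- by move=> z; rewrite lee_fin sqr_ge0.
Qed.

(** Changing the sign of the residual exchanges the positive and negative parts of the integrand.
    Their integrals are thus equal, and integrability makes them finite, so that the difference is
    0. *)
Lemma integral_gauss2_mul_residual (k : R -> R) :
  measurable_fun [set: R] k ->
  P.-integrable setT (fun w => (k (X w) * Z w)%:E) ->
  (\int[P]_w (k (X w) * Z w)%:E = 0)%E.
Proof.
move=> mk ik; rewrite integralE.
pose h (z : R * R) := (Num.max (k z.1 * z.2) 0)%:E.
have mh : measurable_fun [set: R * R] h.
  apply/measurable_EFinP; apply: measurable_maxr => //.
  by apply: measurable_funM => //; exact: measurableT_comp.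
have h0 z : (0 <= h z)%E by rewrite lee_fin le_max lexx orbT.
have -> : (\int[P]_w ((fun w => (k (X w) * Z w)%:E)^\- w) =
    \int[P]_w ((fun w => (k (X w) * Z w)%:E)^\+ w))%E.
  transitivity (\int[P]_w h (X w, (- Z w)%R))%E.
    by apply: eq_integral => w _; rewrite /h /= funenegE mulrN EFin_max.
  rewrite ge0_integral_gauss2_residualN //.
  by apply: eq_integral => w _; rewrite /h /= funeposE EFin_max.
by rewrite subee //; apply: integrable_pos_fin_num.
Qed.

End gaussian_pair.

(** * Square-integrable random variables *)

Section square_integrable.
Local Open Scope ereal_scope.
Context d (T : measurableType d) (R : realType) (P : probability T R).
Implicit Types U V : {mfun T >-> R}.

Lemma integrable_sqr_mul U V :
  P.-integrable setT (fun w => (U w ^+ 2)%:E) ->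
  P.-integrable setT (fun w => (V w ^+ 2)%:E) ->
  P.-integrable setT (fun w => (U w * V w)%:E).
Proof.
move=> iU iV; apply: le_integrable (integrableD measurableT iU iV) => //.
  by apply/measurable_EFinP; exact: measurable_funM.
move=> w _ /=; rewrite lee_fin [leRHS]ger0_norm ?addr_ge0 ?sqr_ge0 //.
by rewrite ler_norml; apply/andP; split; nra.
Qed.

Lemma integrable_sqr U :
  P.-integrable setT (fun w => (U w ^+ 2)%:E) ->
  P.-integrable setT (fun w => (U w)%:E).
Proof.
move=> iU.
pose one : {mfun T >-> R} := cst 1%R.
have i1 : P.-integrable setT (fun w => (one w ^+ 2)%:E).
  rewrite /one /=; under eq_fun do rewrite expr1n.
  exact: finite_measure_integrable_cst.
have := integrable_sqr_mul iU i1.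
by rewrite /one /=; under eq_fun do rewrite mulr1.
Qed.

(** Domination by [2 * (U - a) ^+ 2 + 2 * a ^+ 2], which exceeds [U ^+ 2] by exactly
    [(U - 2 * a) ^+ 2]. *)
Lemma integrable_sqr_center U (a : R) :
  P.-integrable setT (fun w => ((U w - a) ^+ 2)%:E) ->
  P.-integrable setT (fun w => (U w ^+ 2)%:E).
Proof.
move=> iU.
have i2 : P.-integrable setT
    (fun w => 2%:E * ((U w - a) ^+ 2)%:E + (2 * a ^+ 2)%:E).
  apply: integrableD => //; first exact: integrableZl.
  exact: finite_measure_integrable_cst.
apply: le_integrable i2 => //.
  by apply/measurable_EFinP; exact: measurable_funX.
move=> w _ /=; rewrite lee_fin.
rewrite ger0_norm ?sqr_ge0 // (le_trans _ (ler_norm _)) //.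
by have := sqr_ge0 (U w - 2 * a)%R; nra.
Qed.

End square_integrable.

(** * Identification of the regression parameters *)

Section gaussian_regression.
Context d (T : measurableType d) (R : realType) (P : probability T R).
Variables (X Y : {RV P >-> R}) (sx sxy sy : R).
Hypotheses (sx0 : 0 < sx) (D0 : 0 < sx * sy - sxy ^+ 2).
Hypothesis XY : forall A : set (R * R), measurable A ->
  P [set w | A (X w, Y w)] =
  (\int[lebesgue_measure \x lebesgue_measure]_(z in A)
     (gauss2_pdf sx sxy sy z)%:E)%E.
Let b := sxy / sx.
Let tau := Num.sqrt ((sx * sy - sxy ^+ 2) / sx).

Let tau0 : 0 < tau. Proof. by rewrite sqrtr_gt0 divr_gt0. Qed.

Let Zfun w := (Y w - b * X w) / tau.

Let mZ : measurable_fun [set: T] Zfun.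
Proof.
by apply: measurable_funM => //; apply: measurable_funB => //;
    exact: measurable_funM.
Qed.

Let Z : {mfun T >-> R} := HB.pack Zfun (isMeasurableFun.Build _ _ _ _ _ mZ).

Let YE w : Y w = b * X w + tau * Z w.
Proof. by rewrite /= /Zfun [tau * _]mulrC divfK ?gt_eqF // addrC subrK. Qed.

Let iZ2 : P.-integrable setT (fun w => (Z w ^+ 2)%:E).
Proof.
apply/integrableP; split.
  by apply/measurable_EFinP; exact: measurable_funX.
under eq_integral do rewrite /= ger0_norm ?sqr_ge0 //.
by rewrite (integral_gauss2_residual_sqr sx0 D0 XY) ltry.
Qed.

Let iZ := integrable_sqr iZ2.

Let integral_Z : (\int[P]_w (Z w)%:E = 0)%E.
Proof.
have ZE : (fun w => (Z w)%:E) = (fun w => (cst 1 (X w) * Z w)%:E).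
  by apply/funext => w; rewrite mul1r.
rewrite ZE; apply: (integral_gauss2_mul_residual sx0 D0 XY (k := cst 1)) => //.
by rewrite -ZE.
Qed.

Section moments.
Hypothesis X2 : P.-integrable setT (fun w => (X w ^+ 2)%:E).

Let iX := integrable_sqr X2.

Let integral_XZ : (\int[P]_w (X w * Z w)%:E = 0)%E.
Proof.
apply: (integral_gauss2_mul_residual sx0 D0 XY (@measurable_id _ R setT)).
exact: integrable_sqr_mul X2 iZ2.
Qed.

(** In [Y = b * X + tau * Z] both [Z] and [X * Z] have mean 0, so only the term in [b]
    contributes. *)
Lemma gauss2_covariance : covariance P X Y = (b%:E * 'V_P[X])%E.
Proof.
have iXZ := integrable_sqr_mul X2 iZ2.
have EY : ('E_P[Y] = b%:E * 'E_P[X])%E.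
  rewrite !unlock; under eq_integral do rewrite YE EFinD !EFinM.
  rewrite integralD //; [|exact: integrableZl..].
  by rewrite !integralZl // integral_Z mule0 adde0.
have XYE : (fun w => (X w * Y w)%:E) =
    (fun w => (b%:E * (X w ^+ 2)%:E + tau%:E * (X w * Z w)%:E)%E).
  by apply/funext => w; rewrite -!EFinM -EFinD YE; congr EFin; ring.
have iXY : P.-integrable setT (fun w => (X w * Y w)%:E).
  by rewrite XYE; apply: integrableD => //; exact: integrableZl.
have iY : P.-integrable setT (EFin \o Y).
  rewrite [X in integrable _ _ X](_ : _ =
      (fun w => (b%:E * (X w)%:E + tau%:E * (Z w)%:E)%E)); last first.
    by apply/funext => w /=; rewrite YE EFinD !EFinM.
  by apply: integrableD => //; exact: integrableZl.
rewrite /variance !covarianceE ?inE; try exact/Lfun1_integrable.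
have EXX : ('E_P[((X : T -> R) * X)%R] = \int[P]_w (X w ^+ 2)%:E)%E.
  by rewrite unlock.
have -> : ('E_P[((X : T -> R) * Y)%R] = b%:E * 'E_P[((X : T -> R) * X)%R])%E.
  rewrite EXX unlock /= XYE integralD //; [|exact: integrableZl..].
  by rewrite !integralZl // integral_XZ mule0 adde0.
rewrite EY muleBr //.
  by rewrite muleCA.
by rewrite fin_num_adde_defr // EXX; exact: integrable_fin_num.
Qed.

(** Over each event that X lies in [B], the residual integrates to 0: take [k = tau * \1_B] in
    [integral_gauss2_mul_residual]. So [m] and [u |-> b * u] have the same integrals under the law
    of X, hence agree almost everywhere there, and this pulls back along X. *)
Lemma gauss2_condexp m : is_condexp P X Y m ->
  {ae P, forall w, m (X w) = b * X w}.
Proof.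
move=> [iY mm im mE].
have mbX : measurable_fun [set: R] (fun u : R => (b * u)%:E).
  by apply/measurable_EFinP; exact: measurable_funM.
have mmE : measurable_fun [set: R] (EFin \o m) by exact/measurable_EFinP.
have ibX : P.-integrable setT (fun w => (b * X w)%:E).
  by under eq_fun do rewrite EFinM; exact: integrableZl.
have H : ae_eq (distribution P X) setT (EFin \o m) (fun u : R => (b * u)%:E).
  apply: integral_ae_eq => //.
    exact: integrable_pushforward.
  move=> B _ mB.
  have mXB : measurable (X @^-1` B).
    by rewrite -[X in measurable X]setTI; exact: measurable_funP.
  rewrite !integral_pushforward //; last 2 first.
  - exact: integrableS ibX.
  - exact: integrableS im.
  rewrite [LHS](mE B mB) /=; under eq_integral do rewrite /= YE EFinD.
  have iZB : P.-integrable (X @^-1` B) (fun w => (tau * Z w)%:E).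
    apply: (integrableS measurableT) => //.
    by under eq_fun do rewrite EFinM; exact: integrableZl.
  rewrite integralD //; last exact: integrableS ibX.
  rewrite [X in (_ + X)%E](_ : _ = 0%E) ?adde0 //.
  have ZE : (fun w => (tau * Z w)%:E) \_ (X @^-1` B) =
      (fun w => ((tau * \1_B (X w)) * Z w)%:E).
    apply/funext => w; rewrite patchE mulrAC indicE.
    rewrite (_ : (w \in _) = (X w \in B)); last first.
      by apply/idP/idP; rewrite !inE.
    by case: ifP => _; rewrite (mulr1, mulr0).
  rewrite integral_mkcond ZE.
  apply: (integral_gauss2_mul_residual sx0 D0 XY (k := fun u => tau * \1_B u)).
    by apply: measurable_funM => //; exact: measurable_indic.
  rewrite -ZE; exact/(integrable_mkcond _ mXB).
have [A [mA PA0 AH]] := H.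
exists (X @^-1` A); split => //.
- by rewrite -[X in measurable X]setTI; exact: measurable_funP.
- move=> w /= mX; apply: AH => /= mX'; apply: mX.
  by have := mX' I => -[].
Qed.

(** Testing the constant version on the whole space gives [N] as the mean of [(Y - m X) ^+ 2], which
    is almost surely [tau ^+ 2 * Z ^+ 2]. *)
Lemma gauss2_condvar N : is_condvar P X Y (fun=> N) -> N = tau ^+ 2.
Proof.
move=> [m mX [_ _ _ /(_ setT measurableT)]].
have [_ mm _ _] := mX.
rewrite preimage_setT integral_cst //.
rewrite [X in (_ * X)%E](_ : _ = 1%E) ?mule1; last exact: probability_setT.
move=> NE.
apply: EFin_inj; rewrite [LHS]NE.
rewrite -[RHS]mule1 -(integral_gauss2_residual_sqr sx0 D0 XY).
rewrite -ge0_integralZl //; first last.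
- by rewrite lee_fin sqr_ge0.
- by move=> w _; rewrite lee_fin sqr_ge0.
- by apply/measurable_EFinP; exact: (measurable_funX 2 mZ).
apply: ae_eq_integral => //.
- apply/measurable_EFinP/measurable_funX; apply: measurable_funB => //.
  exact: measurableT_comp.
- apply: emeasurable_funM => //; apply/measurable_EFinP.
  exact: (measurable_funX 2 mZ).
have := gauss2_condexp mX; apply: filterS => w mXw _.
by rewrite mXw -EFinM -exprMn [tau * _]mulrC divfK ?gt_eqF.
Qed.

End moments.
End gaussian_regression.

Lemma finite_variance_integrable_sqr d (T : measurableType d) (R : realType)
    (P : probability T R) (X : {RV P >-> R}) (V : R) :
  'V_P[X] = V%:E -> P.-integrable setT (fun w => (X w ^+ 2)%:E).
Proof.
rewrite /variance covariance.unlock expectation.unlock => VX.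
(* The variance is centred at [fine 'E_P[X]], a real number even before the mean is known to be
   finite. *)
apply: (integrable_sqr_center (a := fine 'E_P[X]%E)).
apply/integrableP; split.
  by apply/measurable_EFinP; apply: measurable_funX; exact: measurable_funB.
under eq_integral do rewrite /= ger0_norm ?sqr_ge0 //.
by rewrite expectation.unlock [ltLHS]VX ltry.
Qed.

(** The covariance identifies [c / V] with the slope [sxy / sx] of the density, and the conditional
    variance identifies [N] with the squared scale of the residual. *)
Lemma gaussian_regression_residual d (T : measurableType d) (R : realType)
    (P : probability T R) (X Y : {RV P >-> R}) (V c N : R) :
  0 < V -> centered_bivariate_gaussian P X Y ->
  'V_P[X] = V%:E -> covariance P X Y = c%:E -> is_condvar P X Y (fun=> N) ->
  forall f : R -> \bar R, measurable_fun [set: R] f -> (forall z, 0 <= f z)%E ->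
  (\int[P]_w f ((Y w - c / V * X w) / Num.sqrt N)%R =
   \int[lebesgue_measure]_z ((normal_pdf 0 1 z)%:E * f z))%E.
Proof.
move=> V0 [sx [sxy [sy [sx0 D0 XY]]]] VX CXY NXY f mf f0.
have X2 := finite_variance_integrable_sqr VX.
have -> : c / V = sxy / sx.
  have := gauss2_covariance sx0 D0 XY X2.
  by rewrite CXY VX -EFinM => -[->]; rewrite mulfK // gt_eqF.
have -> : N = (sx * sy - sxy ^+ 2) / sx.
  rewrite (gauss2_condvar sx0 D0 XY X2 NXY) sqr_sqrtr //.
  by rewrite ltW // divr_gt0.
exact: (ge0_integral_gauss2_residual sx0 D0 XY).
Qed.

(** * Products of independent factors *)

Section independence.
Local Open Scope ereal_scope.

Lemma emeasurable_prod d (T : measurableType d) (R : realType) (J : Type)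
    (s : seq J) (Q : pred J) (g : J -> T -> \bar R) :
  (forall j, measurable_fun [set: T] (g j)) ->
  measurable_fun [set: T] (fun w => \prod_(j <- s | Q j) g j w).
Proof.
move=> mg; elim: s => [|j s IH].
  by under eq_fun do rewrite big_nil; exact: measurable_cst.
under eq_fun do rewrite big_cons.
by case: (Q j) => //; exact: emeasurable_funM.
Qed.

Context d d' (T : measurableType d) (T' : measurableType d') (R : realType).
Context (P : probability T R) (I : finType) (Z : I -> T -> T').
Hypothesis mZ : forall i, measurable_fun [set: T] (Z i).

(** The membership in the full index set is kept so that the event has the form used in
    [mutually_independent]. *)
Lemma indic_setIn (A : I -> set T') w :
  \prod_i (\1_(A i) (Z i w))%:E =
  (\1_[set w | forall i, i \in [set: I]%SET -> A i (Z i w)] w)%:E :> \bar R.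
Proof.
rewrite prodEFin; congr EFin.
rewrite indicE; case: (boolP (w \in _)) => [|].
  rewrite inE /= => H; rewrite big1 // => i _; rewrite indicE mem_set //.
  by apply: H; rewrite inE.
rewrite notin_setE /= => H; apply/eqP; apply/prodf_eq0.
have [i Hi] : exists i, ~ A i (Z i w).
  by apply/existsNP => H'; apply: H => i _; exact: H'.
by exists i => //; rewrite indicE memNset.
Qed.

(* Induction on the number of indices [i] where [f i] is not an indicator:
   [ge0_integral_ext] passes from indicators to all nonnegative functions in one
   factor at a time. *)
Lemma mutually_independent_integral_prod (f : I -> T' -> \bar R) :
  mutually_independent P Z ->
  (forall i, measurable_fun [set: T'] (f i)) -> (forall i z, 0 <= f i z) ->
  \int[P]_w \prod_i f i (Z i w) = \prod_i \int[P]_w f i (Z i w).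
Proof.
move=> indep; pose simple (g : T' -> \bar R) :=
  exists2 A, measurable A & g = (EFin \o \1_A).
suff H (n : nat) (J : {set I}) : #|J| = n -> forall f : I -> T' -> \bar R,
    (forall i, measurable_fun [set: T'] (f i)) -> (forall i z, 0 <= f i z) ->
    (forall i, i \notin J -> simple (f i)) ->
    \int[P]_w \prod_i f i (Z i w) = \prod_i \int[P]_w f i (Z i w).
  move=> mf f0; apply: (H _ [set: I]%SET erefl) => // i.
  by rewrite inE.
elim: n J => [|n IH] J cJ {}f mf f0 fs.
  have {}fs i : {A | measurable A & f i = (EFin \o \1_A)}.
    apply: cid2; apply: fs.
    by move/eqP: cJ; rewrite cards_eq0 => /eqP ->; rewrite inE.
  pose A i := s2val (fs i).
  have mA i : measurable (A i) by rewrite /A; case: (fs i).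
  have fE i z : f i z = (\1_(A i) z)%:E.
    by rewrite /A; case: (fs i) => /= ? ? ->.
  have mZA i : measurable (Z i @^-1` A i).
    by rewrite -[X in measurable X]setTI; exact: mZ.
  have mE : measurable [set w | forall i, i \in [set: I]%SET -> A i (Z i w)].
    rewrite (_ : [set w | _] = \bigcap_(i in [set: I]) (Z i @^-1` A i)).
      by apply: fin_bigcap_measurable => // i _; exact: mZA.
    apply/seteqP; split => w /= H i _; last exact: H.
    by apply: H; rewrite inE.
  under eq_integral do (under eq_bigr do rewrite fE; rewrite indic_setIn).
  rewrite integral_indic // setIT.
  apply: etrans (indep [set: I]%SET A mA) _.
  apply: eq_big => [i|i _]; first by rewrite inE.
  under eq_integral do rewrite fE.
  exact/esym/(integral_indic_preimage P (mZ i) (mA i)).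
have [i0 i0J] : exists i, i \in J by apply/set0Pn; rewrite -card_gt0 cJ.
(* The other factors become weights in [ge0_integral_ext]: the random [G] on one side, the constant
   [C] on the other. For an indicator in place of [f i0], the required equality is the induction
   hypothesis for the family [g] below. *)
pose G w := \prod_(i | i != i0) f i (Z i w).
pose C := \prod_(i | i != i0) \int[P]_w f i (Z i w).
have mG : measurable_fun [set: T] G.
  by apply: emeasurable_prod => i; exact: measurableT_comp.
have G0 w : 0 <= G w by apply: prode_ge0.
have C0 : 0 <= C by apply: prode_ge0 => i _; exact: integral_ge0.
rewrite (bigD1 i0) //= -/C.
transitivity (\int[P]_w (G w * f i0 (Z i0 w))).
  by apply: eq_integral => w _; rewrite (bigD1 i0) //= muleC.
rewrite muleC -ge0_integralZl //; last first.
  exact: measurableT_comp.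
refine (ge0_integral_ext (m1 := P) (m2 := P) (Z1 := Z i0) (Z2 := Z i0)
  (g1 := G) (g2 := cst C) _ _ _ _ _ _ _ (mf i0) (f0 i0)) => //.
move=> A mA.
pose g i := if i == i0 then (EFin \o \1_A) else f i.
have mg i : measurable_fun [set: T'] (g i).
  rewrite /g; case: ifP => // _; apply/measurable_EFinP.
  exact: measurable_indic.
have g0 i z : 0 <= g i z by rewrite /g; case: ifP => // _; rewrite lee_fin.
have gs i : i \notin (J :\ i0)%SET -> simple (g i).
  rewrite /g !inE; case: eqP => [_ _|_ /=]; last exact: fs.
  by exists A.
have cJ' : #|(J :\ i0)%SET| = n by move: cJ; rewrite (cardsD1 i0) i0J => -[].
have := IH _ cJ' g mg g0 gs.
rewrite [RHS](bigD1 i0) //= {2}/g eqxx => H.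
transitivity (\int[P]_w \prod_i g i (Z i w)).
  apply: eq_integral => w _; rewrite (bigD1 i0) //= {1}/g eqxx muleC.
  congr (_ * _).
  by apply: eq_bigr => i /negbTE ii0; rewrite /g ii0.
have gC : \prod_(i | i != i0) \int[P]_w g i (Z i w) = C.
  by apply: eq_bigr => i /negbTE ii0; rewrite /g ii0.
rewrite H gC muleC -ge0_integralZl //; last by move=> w _; rewrite lee_fin.
apply: (measurableT_comp _ (mZ i0)).
by apply/measurable_EFinP; exact: measurable_indic.
Qed.

End independence.

(** * Taylor expansion of the rate function *)

Section psi_taylor.
Context (R : realType).
Implicit Types r : R.

Let F r := psi r - 4^-1 * (r - 1) ^+ 2.
Let dF r := - ((r - 1) ^+ 2 * (r + 1)) / (2 * r ^+ 2).

Let is_derive_F r : 0 < r -> is_derive r 1 F (dF r).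
Proof.
move=> r0; have rn0 : r != 0 by rewrite gt_eqF.
have dln := is_derive1_ln r0.
have dV : is_derive r (1 : R) (fun x : R => x^-1) (- r ^- 2).
  by apply: is_derive_eq (is_deriveV (f := id) rn0 _) _; rewrite scaler1.
rewrite /F /psi.
by apply: is_derive_eq; rewrite /dF /GRing.scale /=; field.
Qed.

(** The remainder [F] vanishes at 1 and its derivative [dF] has a double zero there, so the mean
    value theorem yields a cubic bound. For arguments between [2^-1] and [3 / 2], the cofactor
    [(c + 1) / (2 * c ^+ 2)] stays below 5. *)
Lemma psi_taylor r : `|r - 1| < 2^-1 ->
  `|psi r - 4^-1 * (r - 1) ^+ 2| <= 5 * `|(r - 1) ^+ 3|.
Proof.
move=> r1; have r01 : 2^-1 < r < 3 / 2 by move: r1; rewrite ltr_norml; lra.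
have F1 : F 1 = 0 by rewrite /F /psi ln1 invr1 subrr; ring.
have cF a b : 0 < a -> {within `[a, b], continuous F}.
  move=> a0; apply: derivable_within_continuous => x.
  rewrite in_itv /= => /andP[ax _].
  by have [] := is_derive_F (lt_le_trans a0 ax).
have dFb c : 2^-1 < c -> `|c - 1| <= `|r - 1| -> `|dF c| <= 5 * `|r - 1| ^+ 2.
  move=> c0 c1; have c2 : c < 3 / 2
    by have := le_lt_trans c1 r1; rewrite ltr_norml; lra.
  rewrite /dF normrM normrN normrM normrX normfV.
  rewrite [X in _ / X]gtr0_norm; last by nra.
  rewrite [`|c + 1|]gtr0_norm; last by lra.
  rewrite ler_pdivrMr; last by nra.
  have sq : `|c - 1| ^+ 2 <= `|r - 1| ^+ 2 by rewrite lerXn2r.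
  have : c + 1 <= 5 * (2 * c ^+ 2) by nra.
  have := sqr_ge0 `|c - 1|; nra.
have [c [c0 c1 Fr]] : exists c,
    [/\ 2^-1 < c, `|c - 1| <= `|r - 1| & F r = dF c * (r - 1)].
  (* The mean value theorem is applied on the segment between [r] and 1, whose endpoints must be
     given in order. *)
  have [r_le1|/ltW r_ge1] := leP r 1.
    have [||c] := @MVT_segment _ F dF r 1 r_le1.
    + move=> x; rewrite in_itv /= => /andP[rx _]; apply: is_derive_F; lra.
    + by apply: cF; lra.
    rewrite in_itv /= F1 => /andP[rc c1] H; exists c; split; first lra.
    + by rewrite !ler0_norm; lra.
    + lra.
  have [||c] := @MVT_segment _ F dF 1 r r_ge1.
  + by move=> x; rewrite in_itv /= => /andP[rx _]; apply: is_derive_F; lra.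
  + by apply: cF; lra.
  rewrite in_itv /= F1 => /andP[rc c1] H; exists c; split; first lra.
  + by rewrite !ger0_norm; lra.
  + lra.
rewrite -/(F r) Fr normrM normrX exprSr mulrA ler_wpM2r //.
exact: dFb.
Qed.

Lemma psi_bigO r : (psi r : R^o) =
  4^-1 * (r - 1) ^+ 2 +O_(r \near (1 : R)) ((r - 1) ^+ 3 : R^o).
Proof.
move: r; apply/funeqP.
apply/(eqaddOP _ (fun r => psi r : R^o)
  (fun r => 4^-1 * (r - 1) ^+ 2) (fun r => (r - 1) ^+ 3)).
near=> k; near=> x.
apply: le_trans (psi_taylor _) _; last first.
  by rewrite ler_wpM2r //; near: k; exact: nbhs_pinfty_ge.
near: x; apply/nbhs_ballP; exists 2^-1 => //= x.
by rewrite /ball /= distrC.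
Unshelve. all: by end_near.
Qed.

End psi_taylor.

(** * Lower tail of the chi-squared distribution *)

Lemma chi2_lower_tail (R : realType) (n : nat) (mu : set R -> \bar R) (r : R) :
  is_chi2_law n mu -> 1 < r ->
  (mu `]-oo, (n%:R / r)%R]%classic <= (expR (- (n%:R * psi r)))%:E)%E.
Proof.
move=> [d [T [P [Z [indep lawZ muE]]]]] r1.
rewrite muE; last exact: measurable_itv.
have r0 : 0 < r by lra.
(* The choice of [t] below minimizes the Chernoff exponent [t * n / r - n / 2 * ln (1 + 2 * t)]: the
   minimum is at [1 + 2 * t = r], so [integral_normal_expR] applies with [s = Num.sqrt r]. *)
have sr0 : 0 < Num.sqrt r by rewrite sqrtr_gt0.
pose t := (r - 1) / 2.
pose f (z : R) := (expR (- t * z ^+ 2))%:E.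
have mf : measurable_fun [set: R] f.
  apply/measurable_EFinP; apply: measurableT_comp => //.
  by apply: measurable_funM => //; exact: measurable_funX.
have f0 z : (0 <= f z)%E by rewrite lee_fin expR_ge0.
have fZ i : (\int[P]_w f (Z i w) = (Num.sqrt r)^-1%:E)%E.
  rewrite -(integral_normal_expR sr0).
  under eq_integral do rewrite -[f _]mul1e.
  transitivity (\int[lebesgue_measure]_z ((normal_pdf 0 1 z)%:E * f z))%E.
    refine (ge0_integral_ext (m1 := P) (m2 := lebesgue_measure) (Z1 := Z i)
      (Z2 := fun z : R => z) (g1 := cst 1%E)
      (g2 := fun z => (normal_pdf 0 1 z)%:E) _ _ _ _ _ _ _ mf f0) => //=.
    - by apply/measurable_EFinP; exact: measurable_normal_pdf.
    - by move=> x; rewrite lee_fin normal_pdf_ge0.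
    move=> A mA; rewrite -[RHS]integral_mkcond_indic -[RHS]/(normal_prob 0 1 A).
    rewrite -(lawZ i A mA); under eq_integral do rewrite mul1e.
    exact: integral_indic_preimage.
  apply: eq_integral => z _; rewrite /f sqr_sqrtr ?ltW //.
  by congr (_ * (expR _)%:E)%E; rewrite /t; field.
(* The sum is negated because the Chernoff inequality bounds upper tails. *)
have mX : measurable_fun [set: T] (fun w => - \sum_(i < n) Z i w ^+ 2).
  apply: measurableT_comp => //; apply: measurable_sum => i.
  exact: measurable_funX.
pose X : {RV P >-> R} := HB.pack (fun w => - \sum_(i < n) Z i w ^+ 2)
  (isMeasurableFun.Build _ _ _ _ _ mX).
have t0 : 0 < t by rewrite divr_gt0 // subr_gt0.
have MX : ('M_P X t = ((Num.sqrt r)^-1 ^+ n)%:E)%E.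
  transitivity (\int[P]_w \prod_i f (Z i w))%E.
    rewrite /mmt_gen_fun expectation.unlock; apply: eq_integral => w _.
    rewrite prodEFin -expR_sum /=; congr (expR _)%:E.
    by rewrite mulNr mulr_suml -sumrN; apply: eq_bigr => i _; ring.
  rewrite (mutually_independent_integral_prod _ (f := fun=> f)) //.
  under eq_bigr do rewrite fZ.
  by rewrite prodEFin prodr_const card_ord.
have := chernoff X (- (n%:R / r)) t0.
rewrite MX -EFinM.
have -> : [set w | X w >= - (n%:R / r)] =
    [set w | `]-oo, (n%:R / r)]%classic (\sum_(i < n) Z i w ^+ 2)].
  by apply/seteqP; split => w /=; rewrite in_itv /= lerN2.
move=> /le_trans; apply; rewrite lee_fin.
(* As exponentials the two factors merge, and the exponents turn out to be equal. *)
have -> : Num.sqrt r = expR (ln r / 2).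
  rewrite -[in LHS](lnK (_ : r \in Num.pos)) ?posrE //.
  rewrite -[in LHS](divfK (_ : 2 != 0) (ln r)) //.
  by rewrite expRM_natr sqrtr_sqr gtr0_norm ?expR_gt0.
rewrite -expRN -expRM_natl -expRD ler_expR /psi /t.
rewrite le_eqVlt; apply/orP; left; apply/eqP; field.
by rewrite gt_eqF.
Qed.

(** * Law of the sample conditional variance and missed detection *)

Lemma mutually_independent_comp d d' d'' (T : measurableType d)
    (T' : measurableType d') (T'' : measurableType d'') (R : realType)
    (P : probability T R) (I : finType) (Z : I -> T -> T') (phi : T' -> T'') :
  measurable_fun [set: T'] phi ->
  mutually_independent P Z -> mutually_independent P (fun i => phi \o Z i).
Proof.
move=> mphi indep J A mA; apply: (indep J (fun i => phi @^-1` A i)) => i.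
by rewrite -[X in measurable X]setTI; exact: mphi.
Qed.

(** The variables witnessing the chi-squared law are the standardized residuals [phi (x i, y i)]:
    independent as images of independent pairs under one map, and standard normal by
    [gaussian_regression_residual] on indicators. *)
Lemma trusted_correlation_chi2 d (T : measurableType d) (R : realType)
    (P : probability T R) (n : nat) (V_A c N : R) (x y : 'I_n -> {RV P >-> R}) :
  (0 < n)%N -> 0 < V_A -> 0 < N -> trusted_correlation_data V_A c N x y ->
  is_chi2_law n (fun A => P [set w | A (n%:R *
    sample_condvar V_A c (fun i => x i : T -> R) (fun i => y i) w / N)]).
Proof.
move=> n0 V0 N0 [indep _ xy].
pose phi (p : R * R) := (p.2 - c / V_A * p.1) / Num.sqrt N.
have mphi : measurable_fun [set: R * R] phi.
  by apply: measurable_funM => //; apply: measurable_funB => //;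
    exact: measurable_funM.
have mZ i : measurable_fun [set: T] (fun w => phi (x i w, y i w)).
  by apply: measurableT_comp => //; exact: measurable_fun_pair.
pose Z i : {RV P >-> R} := HB.pack (fun w => phi (x i w, y i w))
  (isMeasurableFun.Build _ _ _ _ _ (mZ i)).
exists d, T, P, Z; split.
- exact: (mutually_independent_comp mphi indep).
- move=> i A mA; have [G VX CXY NXY] := xy i.
  have mA1 : measurable_fun [set: R] (EFin \o \1_A : R -> \bar R).
    by apply/measurable_EFinP; exact: measurable_indic.
  have A1 z : (0 <= (EFin \o \1_A : R -> \bar R) z)%E by rewrite lee_fin.
  have := gaussian_regression_residual V0 G VX CXY NXY mA1 A1.
  rewrite -integral_mkcond_indic => residual; apply: etrans _ residual.
  exact/esym/(integral_indic_preimage P (mZ i) mA).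
move=> A mA; congr (P _); apply/funext => w /=; congr (A _).
rewrite /sample_condvar mulrA mulfV ?pnatr_eq0 -?lt0n // mul1r mulr_suml.
by apply: eq_bigr => i _; rewrite /phi /= exprMn exprVn sqr_sqrtr ?ltW.
Qed.

Theorem corollary1 (R : realType) (V_A eta v_el T0 xi0 : R)
    (V_A_gt0 : 0 < V_A) (eta_gt0 : 0 < eta) (eta_le1 : eta <= 1)
    (v_el_ge0 : 0 <= v_el) (T0_gt0 : 0 < T0) (T0_le1 : T0 <= 1)
    (xi0_ge0 : 0 <= xi0) :
  let N0 := noise v_el eta T0 xi0 in
  let c := trusted_corr eta T0 V_A in
  (forall (d : measure_display) (T : measurableType d) (P : probability T R)
      (N_PE : nat) (x y : 'I_N_PE -> {RV P >-> R}) (xi_star : R),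
    let N_star := noise v_el eta T0 xi_star in
    let r_star := N_star / N0 in
    let N_hat := sample_condvar V_A c (fun i => x i : T -> R) (fun i => y i) in
    (1 <= N_PE)%N ->
    1 < r_star ->
    trusted_correlation_data V_A c N_star x y ->
    is_chi2_law N_PE
      (fun A => P [set w | A (N_PE%:R * N_hat w / N_star)]) /\
    (P [set w | (N_hat w <= N0)%R] <=
      (expR (- (N_PE%:R * psi r_star)))%:E)%E)
  /\
  (forall r : R, (psi r : R^o) =
    4^-1 * (r - 1) ^+ 2 +O_(r \near (1 : R)) ((r - 1) ^+ 3 : R^o)).
Proof.
move=> N0 c; split; last exact: psi_bigO.
move=> d T P N_PE x y xi_star N_star r_star N_hat N_PE1 r1 data.
have N00 : 0 < N0.
  rewrite /N0 /noise.
  by have := mulr_ge0 (ltW (mulr_gt0 eta_gt0 T0_gt0)) xi0_ge0; lra.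
(* No sign is assumed for [xi_star]; positivity follows from [1 < r_star] and [0 < N0]. *)
have Ns0 : 0 < N_star.
  by rewrite (lt_trans N00) // -[ltLHS]mul1r -ltr_pdivlMr.
have chi2 := trusted_correlation_chi2 N_PE1 V_A_gt0 Ns0 data.
split; first exact: chi2.
have := chi2_lower_tail chi2 r1.
rewrite (_ : [set w | _] = [set w | N_hat w <= N0]) //.
apply/funext => w; apply/propext.
(* Since [N_PE / r_star = N_PE * N0 / N_star], the chi-squared threshold is the acceptance threshold
   [N0] after the common positive factors cancel. *)
change (N_PE%:R * N_hat w / N_star \in `]-oo, (N_PE%:R / r_star)] <->
  N_hat w <= N0).
move: (N_hat w) => u; rewrite in_itv /= /r_star invf_div.
rewrite [N_PE%:R * (_ / _)]mulrA.
by rewrite ler_pM2r ?invr_gt0 // ler_pM2l // ltr0n.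
Qed.
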